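(* Let $M$ be a (north-west justified) moon polyomino, let $k$ be a positive integer and let $\sigma=\sigma_k(M)$. The complementary map $F\mapsto M\setminus F$ is a bijection from the set $\mathcal{F}_{NE}(M,k)$ of $k$-north-east fillings of $M$ to the set $\mathcal{RP}(\sigma,M)$ of reduced pipe dreams of $\sigma$ living inside $M$ (where fillings are identified with their sets of boxes filled with $1$, and pipe dreams with their sets of crossing boxes).
   Context: Boxes are $(\text{row},\text{column})$ with positive integer coordinates, rows numbered from top to bottom and columns from left to right. A polyomino is a finite set of boxes. It is convex if for any two boxes in it lying in the same row or column, all boxes in between are also in it; it is intersection-free if for any two columns (equivalently rows), one is contained in the other (as sets of row, resp. column, indices). A moon polyomino is a convex, intersection-free polyomino; it is always assumed north-west justified, i.e. it contains boxes in the first row and boxes in the first column. A north-east chain of length $\ell$ in $M$ is a sequence of $\ell$ boxes of $M$ such that each box is strictly north and strictly east of the preceding one, and the smallest rectangle containing all boxes of the sequence is contained in $M$. A $k$-north-east filling of $M$ is a $(0,1)$-filling of $M$ containing no north-east chain of $1$'s of length $k+1$ and in which the number of $1$'s is maximal. A pipe dream of size $n$ is a filling of the boxes $(i,j)$, $i+j\le n$, of the staircase $(n-1,\dots,2,1)$ in which each box contains either two crossing pipes (one joining left and right edges, one joining top and bottom edges) or two turning pipes (one joining left and top edges, one joining bottom and right edges); the boxes $(i,n+1-i)$ carry one turning pipe joining left and top edges. Its permutation $\pi\in\mathcal{S}_n$ is given by $\pi_i=j$ if the pipe starting at the top of column $j$ ends at the left of row $i$. It is reduced if any two pipes cross at most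 once. A pipe dream is identified with its set of crossing boxes, and lives inside $M$ if all its crossings are in $M$. Here $n$ is any integer large enough that $\sigma\in\mathcal{S}_n$ and $M$ is contained in the staircase (permutations are extended by fixed points). For $\sigma\in\mathcal{S}_n$, the diagram is $\mathrm{D}(\sigma)=\{(i,\sigma_j):i<j,\ \sigma_i>\sigma_j\}$ and $r_\sigma(p,q)=\#\{(i,j): i\le p,\ j\le q,\ \sigma(i)=j\}$. The essential set of $\sigma$ is the collection of south-east corner boxes $(p,q)$ of $\mathrm{D}(\sigma)$ (boxes $(p,q)\in \mathrm{D}(\sigma)$ with $(p+1,q),(p,q+1)\notin \mathrm{D}(\sigma)$), each labelled by $r_\sigma(p,q)$; it determines $\sigma$. Definition of $\sigma_k(M)$: for each (inclusion-)maximal rectangle $R\subseteq M$ of width and height both strictly larger than $k$, with north-west corner box $(a+1,b+1)$ and south-east corner box $(i,j)$, mark the box $(i+b,j+a)$ with label $a+b+k$. Then $\sigma_k(M)$ is the permutation whose essential set is this collection of labelled boxes (such a permutation exists). *)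

(* Defs.v *)
From mathcomp Require Import all_boot all_fingroup finmap.
From mathcomp Require Import classical_sets functions.

Set Implicit Arguments.
Unset Strict Implicit.
Unset Printing Implicit Defensive.

Local Open Scope classical_set_scope.
Local Open Scope nat_scope.

(* A box is (row, column), matrix-style, both coordinates counted from 1;
   positivity is imposed by [polyomino]. *)
Definition box : Type := (nat * nat)%type.

Definition polyomino (M : {fset box}) : Prop :=
  forall x, x \in M -> 0 < x.1 /\ 0 < x.2.

Definition convex (M : {fset box}) : Prop :=
  (forall i j1 j j2, (i, j1) \in M -> (i, j2) \in M ->
     j1 <= j <= j2 -> (i, j) \in M) /\
  (forall i1 i i2 j, (i1, j) \in M -> (i2, j) \in M ->
     i1 <= i <= i2 -> (i, j) \in M).

Definition column (M : {fset box}) (j : nat) : set nat :=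
  [set i | (i, j) \in M].

Definition intersection_free (M : {fset box}) : Prop :=
  forall j1 j2, column M j1 `<=` column M j2 \/ column M j2 `<=` column M j1.

Definition north_west_justified (M : {fset box}) : Prop :=
  (exists j, (1, j) \in M) /\ (exists i, (i, 1) \in M).

Definition moon_polyomino (M : {fset box}) : Prop :=
  [/\ polyomino M, convex M, intersection_free M & north_west_justified M].

(* The smallest rectangle containing all boxes of [s]. *)
Definition hull (s : seq box) : set box :=
  [set x | [/\ exists2 y, y \in s & y.1 <= x.1,
               exists2 y, y \in s & x.1 <= y.1,
               exists2 y, y \in s & y.2 <= x.2 &
               exists2 y, y \in s & x.2 <= y.2]].

(* [north_east x y]: [y] is strictly north and strictly east of [x]. *)
Definition north_east : rel box :=
  fun x y => (y.1 < x.1) && (x.2 < y.2).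

Definition ne_chain (M : {fset box}) (s : seq box) : Prop :=
  [/\ {subset s <= M}, sorted north_east s & hull s `<=` [set` M]].

(* A (0,1)-filling of M is given by the set F of its boxes containing a 1. *)
Definition ne_chain_free (k : nat) (M F : {fset box}) : Prop :=
  ~ exists s, [/\ size s = k.+1, {subset s <= F} & ne_chain M s].

Definition ne_filling (k : nat) (M F : {fset box}) : Prop :=
  [/\ (F `<=` M)%fset, ne_chain_free k M F &
      forall G : {fset box}, (G `<=` M)%fset -> ne_chain_free k M G ->
        (#|` G|%fset <= #|` F|%fset)%N].

Inductive edge := North | West | South | East.

(* The edge joined to [e] by a pipe, in a crossing ([x = true]) or a turning
   ([x = false]) box. *)
Definition joined (x : bool) (e : edge) : edge :=
  match x, e with
  | true, North => South | true, South => North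
  | true, West => East | true, East => West
  | false, North => West | false, West => North
  | false, South => East | false, East => South
  end.

Definition in_staircase (n : nat) (D : {fset box}) : Prop :=
  forall x, x \in D -> x.1 + x.2 <= n.

(* [enters D c x e]: in the pipe dream with set of crossings D, the pipe
   starting at the top of column c enters the box x through its edge e.
   A pipe followed from the top only ever leaves a box through South or West.
   All boxes outside D are treated as full turning boxes: if D lies in the
   staircase of size n and c <= n, then on i + j = n + 1 the pipe only ever
   uses the North-West turn, so it never leaves the region i + j <= n + 1. *)
Inductive enters (D : {fset box}) (c : nat) : box -> edge -> Prop :=
| enters_start : enters D c (1, c) North
| enters_below i j e : enters D c (i, j) e ->
    joined ((i, j) \in D) e = South -> enters D c (i.+1, j) North
| enters_left i j e : enters D c (i, j.+2) e ->
    joined ((i, j.+2) \in D) e = West -> enters D c (i, j.+1) East.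

Definition pipe_ends (D : {fset box}) (c i : nat) : Prop :=
  exists2 e, enters D c (i, 1) e & joined ((i, 1) \in D) e = West.

Definition pipes_cross (D : {fset box}) (c d : nat) (x : box) : Prop :=
  x \in D /\ ((enters D c x North /\ enters D d x East) \/
              (enters D c x East /\ enters D d x North)).

(* Elements of 'I_n are 0-based while rows, columns and pipes are 1-based. *)
Definition pipe_dream_perm (n : nat) (D : {fset box}) (s : 'S_n) : Prop :=
  forall i j : 'I_n, s i = j <-> pipe_ends D j.+1 i.+1.

Definition reduced (n : nat) (D : {fset box}) : Prop :=
  forall (c d : 'I_n) (x y : box), c != d ->
    pipes_cross D c.+1 d.+1 x -> pipes_cross D c.+1 d.+1 y -> x = y.

Definition reduced_pipe_dream (n : nat) (s : 'S_n) (M D : {fset box}) : Prop :=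
  [/\ in_staircase n D, pipe_dream_perm D s, reduced n D & (D `<=` M)%fset].

Definition diagram (n : nat) (s : 'S_n) : set box :=
  [set x | exists i j : 'I_n,
     [/\ i < j, s j < s i & x = ((i : nat).+1, (s j : nat).+1)]].

Definition rank_perm (n : nat) (s : 'S_n) (p q : nat) : nat :=
  #|[pred ij : 'I_n * 'I_n | [&& ij.1.+1 <= p, ij.2.+1 <= q & s ij.1 == ij.2]]|.

(* Labelled boxes are encoded as (box, label). *)
Definition essential_set (n : nat) (s : 'S_n) : set (box * nat) :=
  [set z | let: ((p, q), l) := z in
     [/\ diagram s (p, q), ~ diagram s (p.+1, q), ~ diagram s (p, q.+1) &
         l = rank_perm s p q]].

(* The rectangle with north-west corner (a+1, b+1) and south-east corner
   (i, j). *)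
Definition rectangle (a b i j : nat) : set box :=
  [set x | (a < x.1 <= i) && (b < x.2 <= j)].

Definition maximal_rectangle (M : {fset box}) (a b i j : nat) : Prop :=
  rectangle a b i j `<=` [set` M] /\
  (forall a' b' i' j', rectangle a' b' i' j' `<=` [set` M] ->
     rectangle a b i j `<=` rectangle a' b' i' j' ->
     rectangle a' b' i' j' = rectangle a b i j).

Definition marked_boxes (k : nat) (M : {fset box}) : set (box * nat) :=
  [set z | exists a b i j,
     [/\ maximal_rectangle M a b i j, k < i - a, k < j - b &
         z = ((i + b, j + a), a + b + k)]].

(* [s] is the permutation sigma_k(M), seen in 'S_n; an essential set
   determines its permutation. *)
Definition is_sigma (n k : nat) (M : {fset box}) (s : 'S_n) : Prop :=
  essential_set s = marked_boxes k M.

(* Main.v *)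
Require Import Defs.
From mathcomp Require Import all_boot all_fingroup finmap.
From mathcomp Require Import classical_sets functions.
From mathcomp Require Import zify.
From Stdlib Require Import Classical.

(** A filling F of M is read as the pipe dream with set of crossings
    D = M \ F: every box outside D, whether in M or not, is a turn.  The
    theorem rests on the equivalence of two conditions on D.

    Chains.  Let R = [a+1..i] x [b+1..j] be a maximal rectangle of M.  A box
    outside the rows and outside the columns of R is not in M
    ([outside_corner]).  So a chain of k+1 ones in R extends, by b boxes to the
    south-west and a boxes to the north-east, to a chain of a+b+k+1 turns in the
    top left rectangle [1..i+b] x [1..j+a] ([complement_chain_free]).
    Conversely, at most b boxes of such a chain lie below R or to its left, at
    most a lie above R or to its right, and the k+1 others lie in R
    ([chain_free_bound]).  Hence F contains no chain of length k+1 if and only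
    if, for every box (p, q) of the essential set of sigma, with label l, the
    chains of turns of D in [1..p] x [1..q] have length at most l.

    Subwords.  That last condition holds if and only if D contains a reduced
    pipe dream of sigma; this is the theorem of Knutson and Miller on the
    antidiagonals of a matrix Schubert variety.  Reading the rows from top to
    bottom, each from right to left, D is a word in the adjacent
    transpositions.  A chain of m turns in [1..p] x [1..q] forces m of the
    first q pipes to end in the first p rows ([chain_le_rank]), and this number
    is a rank of the permutation of D.  Conversely, the ranks of the Demazure
    product of the word of D are at most lengths of chains of turns
    ([dem_le_chain]); if these satisfy the essential bounds, all ranks of the
    Demazure product are at most those of sigma ([dem_le_rank]), that is, the
    product is above sigma in Bruhat order, and the word contains a reduced
    word of sigma ([subword_lifting]).

    All reduced pipe dreams of sigma have as many crossings as sigma has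
    inversions ([card_reduced]).  The fillings without long chain are the
    complements of the sets of crossings containing a reduced pipe dream of
    sigma, so the largest ones are the complements of the reduced pipe dreams
    themselves. *)

Set Implicit Arguments.
Unset Strict Implicit.
Unset Printing Implicit Defensive.

(** * Words, ranks and Demazure ranks *)

(** The pipes that meet the frontier between the boxes already read and the
    others are numbered along it from north-west to south-east, starting from 0.
    The box (i, j) receives the pipes at positions i+j-2 (from above) and i+j-1
    (from the right).  A turn keeps their order; a crossing exchanges them. *)
Definition level (x : box) : nat := x.1.-1 + x.2.-1.

Definition swap (t p : nat) : nat :=
  if p == t then t.+1 else if p == t.+1 then t else p.

Lemma swapK t : involutive (swap t).
Proof. by move=> p; rewrite /swap; do !case: eqP; lia. Qed.

(** [trace f Z c] is the position, after the crossings of Z, of the pipe c which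
    was at position [f c] before. *)
Definition trace (f : nat -> nat) (Z : seq box) : nat -> nat :=
  foldl (fun h x => swap (level x) \o h) f Z.

Lemma trace_cat f Z1 Z2 : trace f (Z1 ++ Z2) = trace (trace f Z1) Z2.
Proof. exact: foldl_cat. Qed.

Lemma trace_rcons f Z x c :
  trace f (rcons Z x) c = swap (level x) (trace f Z c).
Proof. by rewrite -cats1 trace_cat. Qed.

Lemma trace_inj f Z : injective f -> injective (trace f Z).
Proof.
elim: Z f => //= x Z IH f injf; apply: IH => c d /(can_inj (swapK _)).
exact: injf.
Qed.

Definition rank (f : nat -> nat) (p q : nat) : nat := \sum_(c < q) (f c < p).

Lemma rank_swap_ne f t p q :
  p != t.+1 -> rank (swap t \o f) p q = rank f p q.
Proof. by move=> pt; apply: eq_bigr => c _; rewrite /swap /=; do !case: eqP; lia. Qed.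

Lemma rank_colS f p q : rank f p q.+1 = rank f p q + (f q < p).
Proof. exact: big_ord_recr. Qed.

Lemma rank_rowS f g p q :
  cancel f g -> cancel g f -> rank f p.+1 q = rank f p q + (g p < q).
Proof.
move=> fK gK; elim: q => [|q IH]; first by rewrite /rank !big_ord0.
have e : (g p == q) = (f q == p).
  by rewrite -(inj_eq (can_inj fK)) gK eq_sym.
by rewrite !rank_colS IH; lia.
Qed.

Lemma rank_le_rowS f p q : rank f p q <= rank f p.+1 q.
Proof. by apply: leq_sum => c _; lia. Qed.

Lemma rank_rowS_le f p q : injective f -> rank f p.+1 q <= (rank f p q).+1.
Proof.
move=> injf; have -> : rank f p.+1 q = rank f p q + \sum_(c < q) (f c == p).
  by rewrite -big_split; apply: eq_bigr => c _ /=; lia.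
suff: \sum_(c < q) (f c == p) <= 1 by lia.
case: (pickP (fun c : 'I_q => f c == p)) => [c /eqP fc|no]; last first.
  by rewrite big1 // => c _; rewrite no.
rewrite (bigD1 c) //= big1 ?addn0 ?leq_b1 // => d dc.
by apply/eqP; rewrite eqb0 -fc (inj_eq injf).
Qed.

Lemma rank_id p q : rank id p q = minn p q.
Proof.
elim: q => [|q IH]; first by rewrite /rank big_ord0 minn0.
by rewrite rank_colS IH; lia.
Qed.

(** The effect on ranks of the Demazure product by the transposition (t, t+1),
    which places the larger of the labels at positions t and t+1 at position t:
    at row t+1, the rank then exceeds the rank at row t only if both labels are
    less than q, that is, if the ranks at rows t and t+2 differ by 2. *)
Definition dem_step (t : nat) (r : nat -> nat) : nat -> nat :=
  fun p => if p == t.+1 then maxn (r t) (r t.+2).-1 else r p.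

Definition dem (q : nat) (Z : seq box) : nat -> nat :=
  foldl (fun r x => dem_step (level x) r) (minn^~ q) Z.

Lemma dem_rcons q Z x : dem q (rcons Z x) = dem_step (level x) (dem q Z).
Proof. by rewrite /dem foldl_rcons. Qed.

(** With [dem_col], what remains in terms of ranks of the fact that they count
    the ones of a permutation matrix. *)
Lemma dem_row q Z p : dem q Z p <= dem q Z p.+1 <= (dem q Z p).+1.
Proof.
elim/last_ind: Z p => [|Z x IH] p; first by rewrite /dem /=; lia.
rewrite dem_rcons /dem_step; move: (level x) => t.
have := IH t; have := IH t.+1; have := IH p.
have [->|pt] := eqVneq p t; first by rewrite eqxx ifN; lia.
rewrite eqSS (negPf pt).
by have [->|] := eqVneq p t.+1; lia.
Qed.

Lemma dem_col q Z p : dem q Z p <= dem q.+1 Z p <= (dem q Z p).+1.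
Proof.
elim/last_ind: Z p => [|Z x IH] p; first by rewrite /dem /=; lia.
rewrite !dem_rcons /dem_step; move: (level x) => t.
by have := IH t; have := IH t.+2; have := IH p; case: ifP; lia.
Qed.

Lemma dem_row0 q Z : dem q Z 0 = 0.
Proof.
by elim/last_ind: Z => [|Z x IH]; rewrite ?dem_rcons //; apply: min0n.
Qed.

Lemma dem_col0 Z p : dem 0 Z p = 0.
Proof.
elim/last_ind: Z p => [|Z x IH] p; first by rewrite /dem /=; lia.
by rewrite dem_rcons /dem_step !IH; case: eqP.
Qed.

Lemma dem_le q Z p : dem q Z p <= q.
Proof.
elim: q => [|q IH]; first by rewrite dem_col0.
by have := dem_col q Z p; lia.
Qed.

(** The words in which every crossing increases the number of inversions, that
    is, for f = id, the reduced words. *)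
Fixpoint ascending (f : nat -> nat) (Z : seq box) : Prop :=
  if Z is x :: Z' then
    (forall c d, f c = level x -> f d = (level x).+1 -> c < d) /\
    ascending (swap (level x) \o f) Z'
  else True.

Lemma ascending_cat f Z1 Z2 :
  ascending f (Z1 ++ Z2) <-> ascending f Z1 /\ ascending (trace f Z1) Z2.
Proof. by elim: Z1 f => [|x Z1 IH] f /=; rewrite ?IH; tauto. Qed.

(** The subword property of Bruhat order.  Let (t, t+1) be the last letter of
    the word.  If f has a descent at t, the bound on ranks passes to f composed
    with (t, t+1) and the word without its last letter; a subword for it,
    followed by that letter, is one for f.  Otherwise the bound holds for f
    already without the last letter.  Indeed, of f and its composite with
    (t, t+1), the one without descent at t has the larger rank at row t+1,
    namely the smaller of the rank at row t+2 and the rank at row t plus 1; and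
    this bounds the Demazure rank at row t+1 whatever it was before the last
    letter ([bnd] below). *)
Lemma subword_lifting Z f g : cancel f g -> cancel g f ->
  (forall p q, dem q Z p <= rank f p q) ->
  exists Z', [/\ subseq Z' Z, ascending id Z' & trace id Z' =1 f].
Proof.
elim/last_ind: Z f g => [|Z x IH] f g fK gK le_dem.
  exists [::]; split=> // c; rewrite /trace /=.
  (* The rank at (a+1, a+1) is a+1: pipe a, too, ends in the first a+1 rows. *)
  have fle a : f a <= a.
    have := le_dem a.+1 a.+1; rewrite /dem /= minnn rank_colS.
    suff : rank f a.+1 a <= a by lia.
    rewrite -[leqRHS](card_ord a) -sum1_card.
    by apply: leq_sum => i _; case: (_ < _).
  elim/ltn_ind: c => c IHc; have := fle c; rewrite leq_eqVlt => /orP[/eqP//|].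
  by move=> lt; have := IHc _ lt => /(congr1 g); rewrite !fK => e; lia.
set t := level x.
have ne_t p q : p != t.+1 -> dem q Z p <= rank f p q.
  by move=> pt; have := le_dem p q; rewrite dem_rcons /dem_step (negPf pt).
have bnd q : dem q Z t.+1 <= minn (rank f t q).+1 (rank f t.+2 q).
  have := dem_row q Z t; have := dem_row q Z t.+1.
  have := ne_t t q (negbT (ltn_eqF (ltnSn t))).
  have := ne_t t.+2 q (negbT (gtn_eqF (ltnSn t.+1))).
  by lia.
have [lt|ge] := ltnP (g t) (g t.+1).
  have [|Z' [sub asc eqf]] := IH f g fK gK; last first.
    by exists Z'; split=> //; apply: subseq_trans sub (subseq_rcons _ _).
  move=> p q; have [->|] := eqVneq p t.+1; last exact: ne_t.
  by have := bnd q; rewrite !(rank_rowS _ _ fK gK); lia.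
have fK' : cancel (swap t \o f) (g \o swap t) by move=> c /=; rewrite swapK fK.
have gK' : cancel (g \o swap t) (swap t \o f) by move=> c /=; rewrite gK swapK.
have [|Z' [sub asc eqf]] := IH _ _ fK' gK'.
  move=> p q; have [->|pt] := eqVneq p t.+1; last first.
    by rewrite rank_swap_ne //; apply: ne_t.
  have := bnd q; rewrite (rank_rowS _ _ fK' gK') rank_swap_ne; last by lia.
  rewrite !(rank_rowS _ _ fK gK) /= /swap eqxx; have := ge.
  by have [/(can_inj gK)|] := eqVneq (g t) (g t.+1); lia.
exists (rcons Z' x); split; first by rewrite -!cats1 cat_subseq.
  rewrite -cats1; apply/ascending_cat; split=> //=; split=> // c d.
  rewrite !eqf -/t /= => /(congr1 (swap t)) + /(congr1 (swap t)).
  rewrite !swapK /swap !eqxx ifN; last by lia.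
  move=> /(congr1 g); rewrite fK => -> /(congr1 g); rewrite fK => ->.
  by have [/(can_inj gK)|] := eqVneq (g t) (g t.+1); lia.
by move=> c; rewrite trace_rcons eqf /= swapK.
Qed.

(** * Reading a filling row by row *)

Definition row (n i x : nat) : seq box :=
  [seq (i, j) | j <- rev (iota x.+1 (n - x))].

Fixpoint rows (n i : nat) : seq box :=
  if i is i'.+1 then rows n i' ++ row n i 0 else [::].

Definition crossings (D : {fset box}) (B : seq box) : seq box :=
  [seq x <- B | x \in D].

(** With the lattice point (i, x) at the south-east corner of the box (i, x), the
    frontier after this word goes straight down from (i-1, x) to (i, x): row i
    has been read down to column x+1, and the rows above it completely. *)
Definition before (n : nat) (D : {fset box}) (i x : nat) : seq box :=
  if i is i'.+1 then crossings D (rows n i' ++ row n i x) else [::].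

Definition reading (n : nat) (D : {fset box}) : seq box := before n D n 0.

Lemma mem_row n i x z : (z \in row n i x) = (z.1 == i) && (x < z.2 <= n).
Proof.
case: z => a b; apply/mapP/idP => /= [[j + [-> ->]]|].
  by rewrite mem_rev mem_iota; lia.
by case/andP => /eqP-> h; exists b => //; rewrite mem_rev mem_iota; lia.
Qed.

Lemma mem_rows n i z : (z \in rows n i) = (0 < z.1 <= i) && (0 < z.2 <= n).
Proof.
case: z => a b; elim: i => [|i IH] /=; first by rewrite in_nil; lia.
by rewrite mem_cat IH mem_row /=; case: eqP; lia.
Qed.

Lemma uniq_rows n i : uniq (rows n i).
Proof.
elim: i => //= i IH; rewrite cat_uniq IH map_inj_uniq ?rev_uniq ?iota_uniq //.
  by rewrite andbT; apply/hasPn => z; rewrite mem_row mem_rows; lia.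
by move=> a b [].
Qed.

Lemma row_end n i : row n i n = [::].
Proof. by rewrite /row subnn. Qed.

Lemma row_rcons n i x : x < n -> row n i x = rcons (row n i x.+1) (i, x.+1).
Proof. by move=> h; rewrite /row -(subnSK h) -map_rcons -rev_cons. Qed.

Lemma row_cat n i x : x <= n -> row n i 0 = row n i x ++ row x i 0.
Proof. by move=> h; rewrite /row !subn0 -map_cat -rev_cat -iotaD subnKC. Qed.

Lemma crossings_cat D B1 B2 :
  crossings D (B1 ++ B2) = crossings D B1 ++ crossings D B2.
Proof. exact: filter_cat. Qed.

Lemma before0 n D i : before n D i 0 = crossings D (rows n i).
Proof. by case: i. Qed.

Lemma before_rcons n D i x : x < n ->
  before n D i.+1 x =
  if (i.+1, x.+1) \in D then rcons (before n D i.+1 x.+1) (i.+1, x.+1)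
  else before n D i.+1 x.+1.
Proof.
move=> h; rewrite /before row_rcons // -rcons_cat /crossings filter_rcons.
by [].
Qed.

(** A quantity attached to each point of the frontier that changes only at the
    point moved by the box being read.  Ranks, Demazure ranks and the side on
    which a pipe passes are of this kind. *)
Definition localized T (v : seq box -> nat -> T) : Prop :=
  forall Z x p, p != (level x).+1 -> v (rcons Z x) p = v Z p.

Lemma localized_cat T (v : seq box -> nat -> T) Z W p : localized v ->
  (forall x, x \in W -> p != (level x).+1) -> v (Z ++ W) p = v Z p.
Proof.
move=> loc; elim/last_ind: W => [|W x IH] h; first by rewrite cats0.
rewrite -rcons_cat loc ?IH // => [y yW|]; last by rewrite h ?mem_rcons ?mem_head.
by apply: h; rewrite mem_rcons in_cons yW orbT.
Qed.

(** The value at the lattice point (i, x), which is the point number i + x of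
    any frontier through it. *)
Definition at_corner T (v : seq box -> nat -> T) n D i x : T :=
  v (before n D i x) (i + x).

(** The value at a lattice point is the same for all the frontiers through it
    that occur: after the box to the north-east of (i, x), the next box on the
    same antidiagonal is (i+1, x), and only boxes of that antidiagonal change
    the value at i + x. *)
Lemma at_corner_below T (v : seq box -> nat -> T) n D i x y : localized v ->
  x <= y <= n -> v (before n D i.+1 y) (i + x) = at_corner v n D i x.
Proof.
move=> loc /andP[xy yn]; rewrite /at_corner.
have -> : before n D i.+1 y =
    before n D i x ++
    crossings D ((if i is 0 then [::] else row x i 0) ++ row n i.+1 y).
  case: i => [|i] /=; first by rewrite /row.
  by rewrite -crossings_cat (@row_cat n i.+1 x) ?(leq_trans xy) // !catA.
apply: localized_cat => // z; rewrite mem_filter mem_cat mem_row /level => /andP[_].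
case: i => [|i] /orP[]; rewrite ?mem_row // => /andP[/eqP->] /=; lia.
Qed.

Lemma at_corner_left T (v : seq box -> nat -> T) n D i : localized v ->
  i <= n -> at_corner v n D i 0 = v (reading n D) i.
Proof.
move=> loc; rewrite /reading /at_corner addn0 => le_in.
have stable m : v (before n D (i + m) 0) i = v (before n D i 0) i.
  elim: m => [|m IH]; first by rewrite addn0.
  rewrite -IH addnS !before0 /= crossings_cat localized_cat // => z.
  by rewrite mem_filter mem_row /level => /and3P[_ /eqP->] /=; lia.
by rewrite -(stable (n - i)) subnKC.
Qed.

Lemma at_corner_right T (v : seq box -> nat -> T) n D i : localized v ->
  at_corner v n D i n = v [::] (i + n).
Proof.
move=> loc; case: i => // i; rewrite /at_corner /before row_end cats0.
rewrite -[crossings _ _]cat0s localized_cat // => z.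
by rewrite mem_filter mem_rows /level => /andP[_]; case: z => a b /=; lia.
Qed.

Lemma localized_rank q : localized (fun Z p => rank (trace id Z) p q).
Proof.
move=> Z x p ne; rewrite -(rank_swap_ne (trace id Z) q ne).
by apply: eq_bigr => c _; rewrite trace_rcons.
Qed.

Lemma localized_pipe c : localized (fun Z p => trace id Z c < p).
Proof. by move=> Z x p; rewrite trace_rcons /swap; do !case: eqP; lia. Qed.

Lemma localized_dem q : localized (dem q).
Proof. by move=> Z x p ne; rewrite dem_rcons /dem_step (negPf ne). Qed.

(** The frontier just before the box (i+1, x+1) is read passes through three of
    its corners; reading the box moves the frontier from the north-east corner
    to the south-west one. *)
Lemma corner_nw T (v : seq box -> nat -> T) n D i x : localized v -> x < n ->
  v (before n D i.+1 x.+1) (i + x) = at_corner v n D i x.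
Proof. by move=> loc xn; apply: at_corner_below; rewrite ?leqnSn. Qed.

Lemma corner_ne T (v : seq box -> nat -> T) n D i x : localized v -> x < n ->
  v (before n D i.+1 x.+1) (i + x).+1 = at_corner v n D i x.+1.
Proof. by move=> loc xn; rewrite -addnS; apply: at_corner_below; rewrite ?leqnn. Qed.

Lemma corner_se T (v : seq box -> nat -> T) n D i x :
  v (before n D i.+1 x.+1) (i + x).+2 = at_corner v n D i.+1 x.+1.
Proof. by rewrite /at_corner addSn addnS. Qed.

Lemma corner_turn T (v : seq box -> nat -> T) n D i x : localized v ->
  x < n -> (i.+1, x.+1) \notin D ->
  at_corner v n D i.+1 x = at_corner v n D i x.+1.
Proof.
move=> loc xn xD; rewrite -corner_ne // /at_corner before_rcons // (negPf xD).
by rewrite addSn.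
Qed.

Lemma corner_cross T (v : seq box -> nat -> T) n D i x :
  x < n -> (i.+1, x.+1) \in D ->
  at_corner v n D i.+1 x =
  v (rcons (before n D i.+1 x.+1) (i.+1, x.+1)) (i + x).+1.
Proof. by move=> xn xD; rewrite /at_corner before_rcons // xD addSn. Qed.

(** * North-east chains of turns *)

Lemma north_east_trans : transitive north_east.
Proof. by move=> [a b] [c d] [e f]; rewrite /north_east /=; lia. Qed.

(** Let N(i, x) be the number of the first q pipes that pass north-west of the
    lattice point (i, x).  Then N(i, x) - x does not decrease when moving down
    or to the left, and is nonnegative for x <= q.  The south-west corner of a
    turn has the same N as its north-east corner, but x is smaller by 1: so each
    turn of a chain, followed from north-east to south-west, contributes 1. *)
Lemma chain_le_rank n D q i x s : q <= n -> x <= q ->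
  sorted north_east s ->
  (forall z : box, z \in s -> [/\ z \notin D, 0 < z.1 <= i & x < z.2 <= q]) ->
  size s + x <= at_corner (fun Z p => rank (trace id Z) p q) n D i x.
Proof.
set N := at_corner _ n D => qn.
have loc := @localized_rank q.
have inj Z : injective (trace id Z) by apply: trace_inj.
have down j y : y <= n -> N j y <= N j.+1 y.
  move=> yn; rewrite /N -(@at_corner_below _ _ n D j y y loc) ?leqnn //.
  exact: rank_le_rowS.
have downs j k y : j <= k -> y <= n -> N j y <= N k y.
  move=> /subnKC <- yn; elim: (k - j) => [|m IH]; rewrite ?addn0 // addnS.
  exact: leq_trans (down _ _ yn).
have right j y : y < n -> N j y.+1 <= (N j y).+1.
  move=> yn; rewrite /N -corner_ne // -corner_nw //.
  exact: rank_rowS_le.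
have rights j y z : y <= z <= n -> N j z <= N j y + (z - y).
  case/andP=> /subnKC <- zn; rewrite addKn.
  elim: (z - y) zn => [|m IH] zn; first by rewrite !addn0.
  by have := right j (y + m); have := IH; rewrite !addnS; lia.
elim: s i x => [|z s IH] i x xq /=.
  move=> _ _; apply: leq_trans (downs 0 i x _ _) => //; last exact: leq_trans qn.
  by rewrite /N /at_corner /= rank_id; lia.
move=> srt hs; have [zD hi hx] := hs z (mem_head _ _).
case: z srt hs zD hi hx => [[|a] [|b]] srt hs zD //= hi hx.
have /allP zlt := order_path_min north_east_trans srt.
have h : size s + b.+1 <= N a b.+1.
  apply: IH; [by lia | exact: path_sorted srt |] => y ys.
  have [yD yi yx] := hs y (mem_behead (s := _ :: s) ys).
  by have := zlt y ys; rewrite /north_east /=; split=> //; lia.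
rewrite /N -corner_turn // -/N in h; last by lia.
have : N a.+1 b <= N i b by apply: downs; lia.
have := rights i x b; lia.
Qed.

(** The Demazure ranks obey the recurrence of longest chains in the rows up to i
    and the columns x+1 to q.  A turn in the south-west corner of this region can be
    put at the start of any chain that avoids the last row and the first column.
    With a crossing in that corner, no chain has boxes both in the last row and
    in the first column, and the maximum in [dem_step] tells which to discard. *)
Lemma dem_le_chain n D q i x : q <= n -> x <= n ->
  exists s, [/\ sorted north_east s,
    forall z : box, z \in s -> [/\ z \notin D, 0 < z.1 <= i & x < z.2 <= q] &
    at_corner (dem q) n D i x <= size s + x].
Proof.
move=> qn; have loc := @localized_dem q.
elim: i x => [|i IHi] x xn.
  by exists [::]; split=> //; rewrite /at_corner /dem /=; lia.
have [m] := ubnP (q - x); elim: m x xn => // m IHx x xn xm.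
have [qx|xq] := leqP q x.
  by exists [::]; split=> //; apply: leq_trans qx; apply: dem_le.
have xn' : x < n by exact: leq_trans qn.
have [s [srt hs le_s]] := IHi x.+1 xn'.
have [cross|turn] := boolP ((i.+1, x.+1) \in D); last first.
  rewrite corner_turn //; exists ((i.+1, x.+1) :: s); split; last by rewrite /=; lia.
    rewrite /= path_min_sorted //; apply/allP => -[y1 y2] /hs [_ /= ? ?].
    by rewrite /north_east /=; lia.
  by move=> z; rewrite in_cons => /predU1P[-> | /hs [? ? ?]]; split=> //=; lia.
have [s1 [srt1 hs1 le1]] := IHi x xn.
have [|s2 [srt2 hs2 le2]] := IHx x.+1 xn'; first by lia.
rewrite corner_cross // dem_rcons /dem_step /level /= eqxx.
rewrite corner_nw // corner_se.
case: (leqP (at_corner (dem q) n D i.+1 x.+1).-1 (at_corner (dem q) n D i x)).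
  move=> _; exists s1; split=> // z /hs1 [? ? ?]; split=> //; lia.
by move=> _; exists s2; split=> // [z /hs2 [? ? ?]|]; [split=> //|]; lia.
Qed.

(** * Inversions *)

Lemma trace_comp f Z c : trace f Z c = trace id Z (f c).
Proof.
elim/last_ind: Z => // Z x IH; by rewrite !trace_rcons IH.
Qed.

Lemma trace_revK Z : cancel (trace id (rev Z)) (trace id Z).
Proof.
move=> c; elim/last_ind: Z c => // Z x IH c.
rewrite trace_rcons rev_rcons -[trace id (_ :: _) c]/(trace (swap _) (rev Z) c).
by rewrite [trace (swap _) _ c]trace_comp IH swapK.
Qed.

Definition bounded (n : nat) (Z : seq box) : Prop :=
  forall x, x \in Z -> (level x).+1 < n.

Lemma bounded_rcons n Z x :
  bounded n (rcons Z x) <-> bounded n Z /\ (level x).+1 < n.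
Proof.
split=> [h|[h hx] y].
  by split=> [y yZ|]; apply: h; rewrite mem_rcons ?mem_head // in_cons yZ orbT.
by rewrite mem_rcons in_cons => /predU1P[->//|/h].
Qed.

Lemma trace_lt n Z c : bounded n Z -> (trace id Z c < n) = (c < n).
Proof.
elim/last_ind: Z => // Z x IH /bounded_rcons[/IH <-].
by rewrite trace_rcons /swap; do !case: eqP; lia.
Qed.

Lemma ascendingP Z : ascending id Z <->
  forall Z1 x Z2, Z = Z1 ++ x :: Z2 -> forall c d,
    trace id Z1 c = level x -> trace id Z1 d = (level x).+1 -> c < d.
Proof.
split=> [+ Z1 x Z2 eqZ|]; first by rewrite eqZ => /ascending_cat[_] /= [].
elim/last_ind: Z => // Z x IH h; rewrite -cats1; apply/ascending_cat; split.
  apply: IH => Z1 y Z2 eqZ; apply: (h Z1 y (rcons Z2 x)).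
  by rewrite eqZ rcons_cat.
by split=> //; apply: (h Z x [::]); rewrite cats1.
Qed.

Lemma swap_lt t a b : a < b -> (a, b) <> (t, t.+1) -> swap t a < swap t b.
Proof.
move=> ab ne; have : ~ (a = t /\ b = t.+1) by case=> eqa eqb; apply: ne; congr pair.
by rewrite /swap; do !case: eqP; lia.
Qed.

(** In a reduced word, inversions persist: pipes out of order never meet at a
    crossing again. *)
Lemma ascending_inversion f Z c d : ascending f Z ->
  c < d -> f d < f c -> trace f Z d < trace f Z c.
Proof.
move=> + cd; elim: Z f => //= x Z IH f [asc1 asc] fdc; apply: IH => //=.
by apply: swap_lt => // -[fd fc]; have := asc1 d c fd fc; lia.
Qed.

(** A letter exchanges neighbours on the frontier, so it changes the order of two
    pipes only if they are these neighbours. *)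
Lemma exchange_meets f Z c d : f c < f d -> trace f Z d < trace f Z c ->
  exists Z1 x Z2, [/\ Z = Z1 ++ x :: Z2, trace f Z1 c = level x &
                      trace f Z1 d = (level x).+1].
Proof.
elim: Z f => [|x Z IH] f fcd /=; first by rewrite /trace /=; lia.
have [[fc fd]|] := classic ((f c, f d) = (level x, (level x).+1)).
  by exists [::], x, Z.
move=> ne /IH[|Z1 [y [Z2 [-> h1 h2]]]]; first exact: swap_lt.
by exists (x :: Z1), y, Z2.
Qed.

Definition inversions n (f : nat -> nat) : {set 'I_n * 'I_n} :=
  [set cd : 'I_n * 'I_n | (cd.1 < cd.2) && (f cd.2 < f cd.1)].

(** Each letter of a reduced word adds exactly one inversion, the pair of labels
    that cross there: the order of the other pairs is kept. *)
Lemma card_inversions n Z : bounded n Z -> ascending id Z ->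
  #|inversions n (trace id Z)| = size Z.
Proof.
elim/last_ind: Z => [|Z x IH].
  by move=> _ _; apply/eqP; rewrite cards_eq0; apply/eqP/setP => -[c d];
     rewrite !inE /=; lia.
move=> /bounded_rcons[bZ bx]; rewrite -cats1 => /ascending_cat[ascZ /= [asc _]].
rewrite size_cat addn1 -(IH bZ ascZ).
have brev : bounded n (rev Z) by move=> y; rewrite mem_rev => /bZ.
have lt_c : trace id (rev Z) (level x) < n by rewrite trace_lt //; lia.
have lt_d : trace id (rev Z) (level x).+1 < n by rewrite trace_lt.
set c0 := Ordinal lt_c; set d0 := Ordinal lt_d.
have fc0 : trace id Z c0 = level x by exact: trace_revK.
have fd0 : trace id Z d0 = (level x).+1 by exact: trace_revK.
have injZ : injective (trace id Z) by apply: trace_inj.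
have -> : inversions n (trace id (Z ++ [:: x])) =
          (c0, d0) |: inversions n (trace id Z).
  apply/setP => -[c d]; rewrite !inE cats1 /= !trace_rcons xpair_eqE.
  have -> : (c == c0) = (trace id Z c == level x).
    by rewrite -fc0 (inj_eq injZ).
  have -> : (d == d0) = (trace id Z d == (level x).+1).
    by rewrite -fd0 (inj_eq injZ).
  have := asc c d; have := asc d c.
  have : (trace id Z c == trace id Z d) = (c == d :> nat) by rewrite (inj_eq injZ).
  move: (trace id Z c) (trace id Z d) => a b; rewrite /swap.
  by do !case: eqP; lia.
by rewrite cardsU1 !inE /= fc0 fd0 (ltnNge (level x).+1) leqnSn andbF.
Qed.

(** * Pipes *)

(** Whether pipe c passes north-west of the lattice point (i, x). *)
Definition pipe_nw (n : nat) (D : {fset box}) (c i x : nat) : bool :=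
  at_corner (fun Z p => trace id Z c < p) n D i x.

(** The pipe goes through an edge of the box (i+1, j+1) when the two ends of the
    edge lie on different sides of it. *)
Definition uses (n : nat) (D : {fset box}) (c : nat) (e : edge) (i j : nat) :
    bool :=
  let b := pipe_nw n D c in
  match e with
  | North => b i j.+1 && ~~ b i j
  | West => b i.+1 j && ~~ b i j
  | South => b i.+1 j.+1 && ~~ b i.+1 j
  | East => b i.+1 j.+1 && ~~ b i j.+1
  end.

Definition position (n : nat) (D : {fset box}) (c i j : nat) : nat :=
  trace id (before n D i.+1 j.+1) c.

Lemma usesE n D c e i j : j < n ->
  let p := position n D c i j in
  let p' := if (i.+1, j.+1) \in D then swap (i + j) p else p in
  uses n D c e i j = match e with
                     | North => p == i + j
                     | East => p == (i + j).+1
                     | West => p' == i + j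
                     | South => p' == (i + j).+1
                     end.
Proof.
move=> jn /=; have loc := @localized_pipe c.
have nw : pipe_nw n D c i j = (position n D c i j < i + j).
  by rewrite /pipe_nw -corner_nw.
have ne : pipe_nw n D c i j.+1 = (position n D c i j < (i + j).+1).
  by rewrite /pipe_nw -corner_ne.
have se : pipe_nw n D c i.+1 j.+1 = (position n D c i j < (i + j).+2).
  by rewrite /pipe_nw -corner_se.
have sw : pipe_nw n D c i.+1 j =
    ((if (i.+1, j.+1) \in D then swap (i + j) (position n D c i j)
      else position n D c i j) < (i + j).+1).
  case: ifP => [xD|xD]; first by rewrite /pipe_nw corner_cross // trace_rcons.
  by rewrite /pipe_nw corner_turn ?xD // -corner_ne.
rewrite /uses; case: e; rewrite ?nw ?ne ?se ?sw;
  move: (position n D c i j) => p; case: ((i.+1, j.+1) \in D); rewrite /swap; do ?case: eqP; lia.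
Qed.

Lemma joinedK x : involutive (joined x).
Proof. by case: x => -[]. Qed.

Lemma uses_joined n D c e i j : j < n -> e = North \/ e = East ->
  uses n D c e i j = uses n D c (joined ((i.+1, j.+1) \in D) e) i j.
Proof.
move=> jn; rewrite !usesE //; move: (position n D c i j) => p.
by case=> ->; case: ifP => _; rewrite /= /swap; do ?case: eqP; lia.
Qed.

Lemma pipe_nw_top n D c x : pipe_nw n D c 0 x = (c < x).
Proof. by []. Qed.

(** Pipes followed edge by edge are the pipes of the word.  This direction is an
    induction along the pipe. *)
Lemma enters_uses n D c x e : c < n -> enters D c.+1 x e ->
  exists i j, [/\ x = (i.+1, j.+1), j < n, e = North \/ e = East &
                  uses n D c e i j].
Proof.
move=> cn; elim=> [|i j e' _ [i0 [j0 [[-> ->] jn ne u]]] J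
                   |i j e' _ [i0 [j0 [[-> <-] jn ne u]]] J].
- exists 0, c; split=> //; first by left.
  by rewrite /= !pipe_nw_top ltnSn ltnn.
- exists i0.+1, j0; split=> //; first by left.
  by rewrite uses_joined // J in u.
- exists i0, j; split=> //; [exact: ltnW | by right |].
  by rewrite uses_joined // J in u.
Qed.

(** The converse is an induction against the pipe, on the rows and then on the
    columns from right to left.  On the right boundary no pipe enters, because
    the first n pipes all pass north-west of the point (i, n). *)
Lemma uses_enters n D c i j e : c < n -> j < n -> e = North \/ e = East ->
  uses n D c e i j -> enters D c.+1 (i.+1, j.+1) e.
Proof.
have back a y f : y < n -> f = South \/ f = West -> uses n D c f a y ->
    exists e, [/\ e = North \/ e = East, uses n D c e a y &
                  joined ((a.+1, y.+1) \in D) e = f].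
  move=> yn fE; exists (joined ((a.+1, y.+1) \in D) f).
  have h : joined ((a.+1, y.+1) \in D) f = North \/
           joined ((a.+1, y.+1) \in D) f = East.
    by case: fE => ->; case: (_ \in D); [left|right|right|left].
  by split; rewrite ?joinedK // uses_joined // joinedK.
move=> cn; elim: i j e => [|i IHi] j e.
  have [m] := ubnP (n - j); elim: m j e => // m IHj j e nm jn [->|->] u.
    have -> : j = c by move: u; rewrite /= !pipe_nw_top; lia.
    exact: enters_start.
  have [jn'|nj] := ltnP j.+1 n; last first.
    have e_n : j.+1 = n by lia.
    by move: u; rewrite /= pipe_nw_top e_n; lia.
  have [|e' [ne' u' J]] := back 0 j.+1 West jn' _ u; first by right.
  by apply: enters_left J; apply: IHj => //; lia.
have [m] := ubnP (n - j); elim: m j e => // m IHj j e nm jn [->|->] u.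
  have [|e' [ne' u' J]] := back i j South jn _ u; first by left.
  by apply: enters_below J; apply: IHi.
have [jn'|nj] := ltnP j.+1 n; last first.
  have e_n : j.+1 = n by lia.
  move: u; rewrite /= e_n /pipe_nw !at_corner_right; last exact: localized_pipe.
    by rewrite /trace /=; lia.
  exact: localized_pipe.
have [|e' [ne' u' J]] := back i.+1 j.+1 West jn' _ u; first by right.
by apply: enters_left J; apply: IHj => //; lia.
Qed.

Lemma pipe_endsE n D c i : c < n -> i < n ->
  pipe_ends D c.+1 i.+1 <-> trace id (reading n D) c = i.
Proof.
move=> cn i_n; have n0 : 0 < n by exact: leq_ltn_trans cn.
have -> : trace id (reading n D) c = i <-> uses n D c West i 0.
  have loc := @localized_pipe c.
  by rewrite /= /pipe_nw !at_corner_left ?(ltnW i_n) //; split; lia.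
split=> [[e /(enters_uses cn)[i' [j' [[<- <-] jn ne u]]] J]|u].
  by rewrite uses_joined // J in u.
exists (joined ((i.+1, 1) \in D) West); last by case: (_ \in D).
have ne : joined ((i.+1, 1) \in D) West = North \/
          joined ((i.+1, 1) \in D) West = East.
  by case: (_ \in D); [right|left].
by apply: (@uses_enters n) => //; rewrite uses_joined // joinedK.
Qed.

Lemma pipes_crossE n D c d x : c < n -> d < n ->
  pipes_cross D c.+1 d.+1 x <->
  x \in D /\ exists i j, [/\ x = (i.+1, j.+1), j < n &
    (position n D c i j = i + j /\ position n D d i j = (i + j).+1) \/
    (position n D d i j = i + j /\ position n D c i j = (i + j).+1)].
Proof.
move=> cn dn; rewrite /pipes_cross; split.
  case=> xD h; split=> //.
  by case: h => -[/(enters_uses cn)[i [j [ex jn _ uc]]]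
                  /(enters_uses dn)[i' [j' []]]];
    rewrite ex => -[<- <-] _ _ ud; exists i, j; split=> //;
    move: uc ud; rewrite !usesE // => /eqP -> /eqP ->; [left|right].
case=> xD [i [j [ex jn h]]]; split=> //; rewrite ex.
have north a : position n D a i j = i + j -> uses n D a North i j.
  by rewrite usesE // => ->.
have east a : position n D a i j = (i + j).+1 -> uses n D a East i j.
  by rewrite usesE // => ->.
case: h => -[/north uN /east uE]; [left|right].
  by split; [apply: uses_enters uN | apply: uses_enters uE] => //; [left|right].
by split; [apply: uses_enters uE | apply: uses_enters uN] => //; [right|left].
Qed.

(** * Reducedness *)

Definition positive (D : {fset box}) : Prop :=
  forall x, x \in D -> 0 < x.1 /\ 0 < x.2.

Lemma mem_reading n D x : positive D -> in_staircase n D ->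
  (x \in reading n D) = (x \in D).
Proof.
move=> pos stair; rewrite /reading before0 mem_filter mem_rows.
have [xD|//] := boolP (x \in D); have := stair x xD; have := pos x xD.
by case: x {xD} => a b /=; lia.
Qed.

Lemma uniq_reading n D : uniq (reading n D).
Proof. by rewrite /reading before0 filter_uniq ?uniq_rows. Qed.

Lemma size_reading n D : positive D -> in_staircase n D ->
  size (reading n D) = #|` D|%fset.
Proof.
move=> pos stair; apply/perm_size/uniq_perm; rewrite ?uniq_reading ?fset_uniq //.
by move=> x; rewrite mem_reading.
Qed.

Lemma bounded_reading n D : in_staircase n D -> bounded n (reading n D).
Proof.
move=> stair x; rewrite /reading before0 mem_filter mem_rows.
by case/andP=> /stair; case: x => a b; rewrite /level /=; lia.
Qed.

Lemma rows_prefix n i m : exists T, rows n (i + m) = rows n i ++ T.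
Proof.
elim: m => [|m [T eqT]]; first by exists [::]; rewrite addn0 cats0.
by exists (T ++ row n (i + m).+1 0); rewrite addnS /= eqT catA.
Qed.

(** The prefix of the word before a given crossing is known explicitly, which
    ties the crossings of the word to the boxes of the pipe dream. *)
Lemma reading_split n D i j : i < n -> j < n -> (i.+1, j.+1) \in D ->
  exists Z, reading n D = before n D i.+1 j.+1 ++ (i.+1, j.+1) :: Z.
Proof.
move=> i_n jn xD; have [T eqT] := rows_prefix n i.+1 (n - i.+1).
rewrite subnKC // in eqT.
exists (crossings D (row j i.+1 0 ++ T)).
rewrite /reading before0 eqT /= (@row_cat n i.+1 j) 1?ltnW // row_rcons //.
by rewrite -cats1 -!catA /before /crossings !filter_cat /= xD -!catA.
Qed.

Lemma cat_cons_eq (T : Type) (x y : T) Z1 Z2 W1 W2 :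
  Z1 ++ x :: Z2 = W1 ++ y :: W2 ->
  [\/ Z1 = W1 /\ x = y, exists Y, W1 = Z1 ++ x :: Y |
      exists Y, Z1 = W1 ++ y :: Y].
Proof.
elim: Z1 W1 => [|z Z1 IH] [|w W1] /= [].
- by move=> -> _; constructor 1.
- by move=> <- _; constructor 2; exists W1.
- by move=> -> _; constructor 3; exists Z1.
move=> <- /IH[[-> ->]|[Y ->]|[Y ->]]; first by constructor 1.
  by constructor 2; exists Y.
by constructor 3; exists Y.
Qed.

Lemma uniq_split (T : eqType) (x : T) Z1 Z2 W1 W2 : uniq (Z1 ++ x :: Z2) ->
  Z1 ++ x :: Z2 = W1 ++ x :: W2 -> Z1 = W1.
Proof.
move=> u e; case: (cat_cons_eq e) => [[]//|[Y eqW]|[Y eqZ]].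
  move: u; rewrite e cat_uniq eqW => /and3P[_ /hasPn/(_ x (mem_head _ _))].
  by rewrite mem_cat mem_head orbT.
move: u; rewrite cat_uniq eqZ => /and3P[_ /hasPn/(_ x (mem_head _ _))].
by rewrite mem_cat mem_head orbT.
Qed.

Definition meet (Z : seq box) (x : box) (c d : nat) : Prop :=
  trace id Z c = level x /\ trace id Z d = (level x).+1.

(** After their first crossing, two pipes of a reduced word are out of order and
    stay so, while a second crossing would find them in order. *)
Lemma ascending_meet_once Z x T y R c d c' d' :
  ascending id (Z ++ x :: T ++ y :: R) -> meet Z x c d ->
  (c', d') = (c, d) \/ (c', d') = (d, c) -> ~ meet (Z ++ x :: T) y c' d'.
Proof.
move=> /ascendingP asc [mc md]; have cd : c < d by apply: asc mc md.
have inv : trace id (Z ++ x :: T) d < trace id (Z ++ x :: T) c.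
  have /ascending_cat[_ [_ /ascending_cat[ascT _]]] :=
    (ascendingP (Z ++ x :: T ++ y :: R)).2 asc.
  rewrite trace_cat; apply: (ascending_inversion ascT) => //=.
  by rewrite mc md /swap; do !case: eqP; lia.
have eqZ : Z ++ x :: T ++ y :: R = (Z ++ x :: T) ++ y :: R by rewrite -catA.
case=> -[-> ->] [m1 m2]; last by have := asc _ _ _ eqZ _ _ m1 m2; lia.
by move: inv; rewrite m1 m2; lia.
Qed.

(** If two pipes cross when already out of order, they have crossed before, so
    they cross twice; the converse is [ascending_meet_once]. *)
Lemma reduced_ascending n D : positive D -> in_staircase n D ->
  reduced n D <-> ascending id (reading n D).
Proof.
move=> pos stair; have posx := mem_reading _ pos stair.
have split_at x : x \in D -> exists i j Z,
    [/\ x = (i.+1, j.+1), i < n, j < n &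
     reading n D = before n D i.+1 j.+1 ++ x :: Z].
  move=> xD; have := pos x xD; have := stair x xD.
  case: x xD => [[|i] [|j]] xD h [] //= _ _; rewrite /= in h.
  have i_n : i < n by lia.
  have jn : j < n by lia.
  by have [Z eqZ] := reading_split i_n jn xD; exists i, j, Z.
split=> [red|asc].
  apply/ascendingP => Z1 x Z2 eqR c d mc md; rewrite ltnNge; apply/negP => dc.
  have bZ : bounded n Z1.
    by move=> y yZ; apply: (@bounded_reading n D) => //; rewrite eqR mem_cat yZ.
  have bx : (level x).+1 < n.
    by apply: (@bounded_reading n D) => //; rewrite eqR mem_cat mem_head orbT.
  have cn : c < n by rewrite -(trace_lt c bZ) mc ltnW.
  have dn : d < n by rewrite -(trace_lt d bZ) md.
  have ne_cd : d != c by apply: contraPneq md => ->; rewrite mc; lia.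
  have [||Y1 [y [Y2 [eqZ m1 m2]]]] := @exchange_meets id Z1 d c.
  - by rewrite /= ltn_neqAle ne_cd.
  - by rewrite mc md.
  have xD : x \in D by rewrite -posx eqR mem_cat mem_head orbT.
  have yZ : y \in Z1 by rewrite eqZ mem_cat mem_head orbT.
  have yD : y \in D by rewrite -posx eqR mem_cat yZ.
  have uR := uniq_reading n D.
  have eqxy : x = y.
    have [ix [jx [Zx [ex _ jxn eqx]]]] := split_at x xD.
    have [iy [jy [Zy [ey _ jyn eqy]]]] := split_at y yD.
    apply: (red (Ordinal dn) (Ordinal cn)); first by [].
      apply/(pipes_crossE _ _ dn cn); split=> //; exists ix, jx; split=> //; right.
      have e : before n D ix.+1 jx.+1 = Z1.
        by apply: (@uniq_split _ x _ Zx _ Z2); rewrite -eqx.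
      by rewrite /position e mc md ex.
    apply/(pipes_crossE _ _ dn cn); split=> //; exists iy, jy; split=> //; left.
    have e : before n D iy.+1 jy.+1 = Y1.
      apply: (@uniq_split _ y _ Zy _ (Y2 ++ x :: Z2)); rewrite -eqy //.
      by rewrite eqR eqZ -catA.
    by rewrite /position e m1 m2 ey.
  move: uR; rewrite eqR cat_uniq => /and3P[_ /hasPn/(_ x (mem_head _ _))].
  by rewrite eqxy yZ.
move=> c d x y ne_cd /(pipes_crossE _ _ (ltn_ord c) (ltn_ord d))[xD crx].
move=> /(pipes_crossE _ _ (ltn_ord c) (ltn_ord d))[yD cry].
have meetE z i j : z = (i.+1, j.+1) ->
    (position n D c i j = i + j /\ position n D d i j = (i + j).+1) \/
    (position n D d i j = i + j /\ position n D c i j = (i + j).+1) ->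
    exists e f, ((e, f) = (c : nat, d : nat) \/ (e, f) = (d : nat, c : nat)) /\
      meet (before n D i.+1 j.+1) z e f.
  move=> -> [] h; [exists (c : nat), (d : nat) | exists (d : nat), (c : nat)].
    by split=> //; left.
  by split=> //; right.
have cross_split z : z \in D -> (exists i j, [/\ z = (i.+1, j.+1), j < n &
    (position n D c i j = i + j /\ position n D d i j = (i + j).+1) \/
    (position n D d i j = i + j /\ position n D c i j = (i + j).+1)]) ->
    exists Z1 Z2 e f, [/\ reading n D = Z1 ++ z :: Z2, meet Z1 z e f &
      (e, f) = (c : nat, d : nat) \/ (e, f) = (d : nat, c : nat)].
  move=> zD [i [j [ez jn h]]].
  have [i' [j' [Z [ez' _ _ eqZ]]]] := split_at z zD.
  have [eqi eqj] : i' = i /\ j' = j by move: ez'; rewrite ez => -[].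
  have [e [f [efE m]]] := meetE z i j ez h.
  by exists (before n D i.+1 j.+1), Z, e, f; split=> //; rewrite eqZ eqi eqj.
have [Z1 [Z2 [e [f [eqx mx efE]]]]] := cross_split x xD crx.
have [W1 [W2 [e' [f' [eqy my efE']]]]] := cross_split y yD cry.
have efE1 : (e', f') = (e, f) \/ (e', f') = (f, e).
  by case: efE efE' => -[-> ->] [] [-> ->]; [left|right|right|left].
have efE2 : (e, f) = (e', f') \/ (e, f) = (f', e').
  by case: efE1 => -[-> ->]; [left|right].
have eqR := eqx; rewrite eqy in eqR.
case: (cat_cons_eq eqR) => [[_ -> //]|[Y eqZ]|[Y eqW]].
  rewrite eqx eqZ -catA /= in asc.
  by rewrite eqZ in mx; case/(ascending_meet_once asc my efE2): mx.
rewrite eqy eqW -catA /= in asc.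
by rewrite eqW in my; case/(ascending_meet_once asc mx efE1): my.
Qed.

(** * Permutations and their essential sets *)

(** Permutations of all natural numbers fixing those from n on, so that ranks
    and positions need no bound. *)
Definition extend n (s : 'S_n) (c : nat) : nat :=
  if insub c is Some i then val (s i) else c.

Lemma extend_ord n (s : 'S_n) (i : 'I_n) : extend s i = s i.
Proof. by rewrite /extend valK. Qed.

Lemma extend_ge n (s : 'S_n) c : n <= c -> extend s c = c.
Proof. by move=> h; rewrite /extend insubF // ltnNge h. Qed.

Lemma extend_lt n (s : 'S_n) c : c < n -> extend s c < n.
Proof. by move=> h; rewrite -[c]/(val (Ordinal h)) extend_ord. Qed.

Lemma extendVK n (s t : 'S_n) : (forall i, t (s i) = i) ->
  cancel (extend s) (extend t).
Proof.
move=> sK c; have [cn|nc] := ltnP c n; last by rewrite !extend_ge.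
by rewrite -[c]/(val (Ordinal cn)) !extend_ord sK.
Qed.

Lemma extendK n (s : 'S_n) : cancel (extend s) (extend (s^-1)%g).
Proof. by apply: extendVK => i; rewrite permK. Qed.

Lemma extendKV n (s : 'S_n) : cancel (extend (s^-1)%g) (extend s).
Proof. by apply: extendVK => i; rewrite permKV. Qed.

Lemma diagramE n (s : 'S_n) p q : diagram s (p.+1, q.+1) <->
  (q < extend s p) && (p < extend (s^-1)%g q).
Proof.
split=> [[i [j [ij ji [-> ->]]]]|].
  by rewrite !extend_ord permK ji.
have [pn|np] := ltnP p n; have [qn|nq] := ltnP q n.
- rewrite -[p]/(val (Ordinal pn)) -[q]/(val (Ordinal qn)) !extend_ord /=.
  case/andP=> h1 h2; exists (Ordinal pn), ((s^-1)%g (Ordinal qn)).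
  by rewrite permKV.
- have := extend_lt s pn; rewrite (extend_ge _ nq); lia.
- have := extend_lt (s^-1)%g qn; rewrite (extend_ge _ np); lia.
- by rewrite !extend_ge //; lia.
Qed.

Lemma diagram_lt n (s : 'S_n) p q : diagram s (p, q) -> p <= n /\ q <= n.
Proof. by case=> i [j [_ _ [-> ->]]]. Qed.

Lemma rank_permE n (s : 'S_n) p q : p <= n -> q <= n ->
  rank_perm s p q = rank (extend (s^-1)%g) p q.
Proof.
move=> pn qn; rewrite /rank_perm /rank.
rewrite (big_ord_widen n (fun c => nat_of_bool (extend (s^-1)%g c < p)) qn).
rewrite -sum1_card big_mkcond /=.
transitivity (\sum_(i < n) \sum_(j < n)
    nat_of_bool [&& i.+1 <= p, j.+1 <= q & s i == j]).
  by rewrite pair_bigA; apply: eq_bigr => ij _; rewrite inE /=; case: ifP.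
rewrite exchange_big [RHS]big_mkcond; apply: eq_bigr => j _.
rewrite (bigD1 ((s^-1)%g j)) //= permKV eqxx andbT big1 => [|i ne].
  by rewrite addn0 extend_ord; case: (j < q); rewrite ?andbT ?andbF.
suff /negPf-> : s i != j by rewrite !andbF.
by apply: contraNneq ne => <-; rewrite permK.
Qed.

(** Fulton's argument that the essential set suffices, with the Demazure ranks
    as the smaller ranks.  Moving south or east inside the diagram leaves the
    ranks of s unchanged while the other ranks do not decrease, so the bound
    spreads from the south-east corners to the diagram.  Outside the diagram,
    the rank of s grows by 1 when the row, or the column, is added; the other
    rank grows by at most 1. *)
Lemma dem_le_rank n (s : 'S_n) Z :
  (forall p q l, essential_set s ((p, q), l) -> dem q Z p <= l) ->
  forall p q, dem q Z p <= rank (extend (s^-1)%g) p q.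
Proof.
set f := extend (s^-1)%g; set g := extend s => ess.
have fK : cancel f g by apply: extendKV.
have gK : cancel g f by apply: extendK.
have rowS p q : rank f p.+1 q = rank f p q + (g p < q) by apply: rank_rowS.
have in_diagram p q : q < g p -> p < f q ->
    dem q.+1 Z p.+1 <= rank f p.+1 q.+1.
  have [m] := ubnP (n + n - (p + q)); elim: m p q => // m IH p q hm qg pf.
  have dpq : diagram s (p.+1, q.+1) by apply/diagramE; rewrite qg.
  have [pn qn] := diagram_lt dpq.
  have [d1|d1] := boolP ((q < g p.+1) && (p.+1 < f q)).
    case/andP: d1 => d1 d2; have := IH p.+1 q; have := dem_row q.+1 Z p.+1.
    by rewrite (rowS p.+1); lia.
  have [d2|d2] := boolP ((q.+1 < g p) && (p < f q.+1)).
    case/andP: d2 => d2 d3; have := IH p q.+1; have := dem_col q.+1 Z p.+1.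
    by rewrite (rank_colS f p.+1 q.+1); lia.
  rewrite -rank_permE //; apply: ess; split=> //.
    by move/diagramE; apply/negP.
  by move/diagramE; apply/negP.
elim=> [|p IHp] q; first by rewrite dem_row0.
elim: q => [|q IHq]; first by rewrite dem_col0.
have [qg|gq] := ltnP q (g p).
  have [pf|fp] := ltnP p (f q); first exact: in_diagram.
  have := dem_col q Z p.+1; rewrite (rank_colS f p.+1 q); lia.
have := dem_row q.+1 Z p; have := IHp q.+1; rewrite rowS; lia.
Qed.

(** * Reduced pipe dreams inside a set of crossings *)

Lemma pipe_dream_permE n D (s : 'S_n) : pipe_dream_perm D s <->
  forall c : 'I_n, trace id (reading n D) c = extend (s^-1)%g c.
Proof.
split=> [h c|h i j].
  apply/(pipe_endsE D (ltn_ord c) (extend_lt (s^-1)%g (ltn_ord c))).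
  by rewrite extend_ord; apply/h; rewrite permKV.
rewrite (pipe_endsE D (ltn_ord j) (ltn_ord i)) h extend_ord.
split=> [<-|/val_inj <-]; by rewrite ?permK ?permKV.
Qed.

Lemma card_reduced n D (s : 'S_n) : positive D -> in_staircase n D ->
  pipe_dream_perm D s -> reduced n D ->
  #|` D|%fset = #|inversions n (extend (s^-1)%g)|.
Proof.
move=> pos stair /pipe_dream_permE tr /(reduced_ascending pos stair) asc.
rewrite -(size_reading pos stair) -(@card_inversions n _ _ asc).
  by apply: eq_card => cd; rewrite !inE !tr.
exact: bounded_reading.
Qed.

Lemma rank_perm_chain n D (s : 'S_n) p q t : p <= n -> q <= n ->
  pipe_dream_perm D s -> sorted north_east t ->
  (forall z : box, z \in t -> [/\ z \notin D, 0 < z.1 <= p & 0 < z.2 <= q]) ->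
  size t <= rank_perm s p q.
Proof.
move=> pn qn /pipe_dream_permE tr srt ht; rewrite rank_permE //.
have := @chain_le_rank n D q p 0 t qn (leq0n q) srt ht.
rewrite addn0 at_corner_left //; last exact: localized_rank.
suff -> : rank (trace id (reading n D)) p q = rank (extend (s^-1)%g) p q by [].
apply: eq_bigr => c _; have cn : c < n by apply: leq_trans qn.
by rewrite (tr (Ordinal cn)).
Qed.

(** The subword of the word of D given by [subword_lifting] is the word of the
    set of its letters, because no box is read twice. *)
Lemma contains_reduced n D (s : 'S_n) : positive D -> in_staircase n D ->
  (forall p q l t, essential_set s ((p, q), l) -> sorted north_east t ->
    (forall z : box, z \in t -> [/\ z \notin D, 0 < z.1 <= p & 0 < z.2 <= q]) ->
    size t <= l) ->
  exists D', reduced_pipe_dream s D D'.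
Proof.
move=> pos stair short.
have [|Z [subZ ascZ trZ]] :=
    subword_lifting (extendKV s) (extendK s) (Z := reading n D).
  apply: dem_le_rank => p q l ess.
  have [pn qn] : p <= n /\ q <= n by case: ess => /diagram_lt.
  have loc := @localized_dem q.
  have [t [srt ht le_t]] := @dem_le_chain n D q p 0 qn isT.
  rewrite at_corner_left // addn0 in le_t; apply: leq_trans le_t _.
  exact: short ess srt ht.
pose D' := [fset x in Z]%fset.
have subD : (D' `<=` D)%fset.
  apply/fsubsetP => x; rewrite !inE => /(mem_subseq subZ).
  by rewrite mem_reading.
have stair' : in_staircase n D' by move=> x /(fsubsetP subD); apply: stair.
have pos' : positive D' by move=> x /(fsubsetP subD); apply: pos.
have eqZ : reading n D' = Z.
  have /(subseq_uniqP (uniq_reading n D))-> := subZ.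
  rewrite /reading !before0 /crossings -filter_predI; apply: eq_filter => x /=.
  rewrite inE /=; apply/idP/andP => [xZ|[]//]; split=> //.
  by apply: (fsubsetP subD); rewrite inE.
exists D'; split=> //; last by apply/(reduced_ascending pos' stair'); rewrite eqZ.
by apply/pipe_dream_permE => c; rewrite eqZ trZ.
Qed.

(** * Chains in rectangles *)

Lemma chain_width t lo hi : sorted north_east t ->
  (forall z : box, z \in t -> lo < z.2 <= hi) -> size t <= hi - lo.
Proof.
move=> srt ht; rewrite -(size_map snd) -(size_iota lo.+1 (hi - lo)).
apply: uniq_leq_size => [|y /mapP[z /ht hz ->]]; last first.
  by rewrite mem_iota; move: hz; case: (z) => a b /=; lia.
apply: (sorted_uniq ltn_trans ltnn); rewrite sorted_map.
by apply: sub_sorted srt => -[a b] [c d]; rewrite /north_east /=; lia.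
Qed.

Lemma chain_height t lo hi : sorted north_east t ->
  (forall z : box, z \in t -> lo < z.1 <= hi) -> size t <= hi - lo.
Proof.
move=> srt ht; rewrite -(size_map fst) -(size_iota lo.+1 (hi - lo)).
apply: uniq_leq_size => [|y /mapP[z /ht hz ->]]; last first.
  by rewrite mem_iota; move: hz; case: (z) => a b /=; lia.
apply: (@sorted_uniq _ gtn); [by move=> x y z /=; lia | exact: ltnn |].
rewrite sorted_map.
by apply: sub_sorted srt => -[a b] [c d]; rewrite /north_east /=; lia.
Qed.

(** The last box of the chain decides.  If it is below row i, so are all of
    them, and they occupy distinct rows among b; if it is in the first b
    columns, so are all of them. *)
Lemma chain_start_bound t b i : sorted north_east t ->
  (forall z : box, z \in t -> [/\ z.1 <= i + b, 0 < z.2 & (i < z.1) || (z.2 <= b)]) ->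
  size t <= b.
Proof.
case/lastP: t => // t l srt ht.
have lt_l z : z \in t -> north_east z l.
  move: srt; rewrite (sorted_pairwise north_east_trans) pairwise_rcons.
  by case/andP=> /allP h _ /h.
have [|_ _ /orP[il|lb]] := ht l; first by rewrite mem_rcons mem_head.
  rewrite -[leqRHS](addKn i); apply: chain_height srt _ => z zt.
  have [zi _ _] := ht z zt; rewrite zi andbT; move: zt.
  rewrite mem_rcons in_cons => /predU1P[->//|/lt_l].
  by rewrite /north_east; lia.
rewrite -[leqRHS]subn0; apply: chain_width srt _ => z zt.
have [_ z0 _] := ht z zt; rewrite z0; move: zt.
rewrite mem_rcons in_cons => /predU1P[->//|/lt_l].
by rewrite /north_east; lia.
Qed.

Lemma chain_end_bound t a j : sorted north_east t ->
  (forall z : box, z \in t -> [/\ z.2 <= j + a, 0 < z.1 & (z.1 <= a) || (j < z.2)]) ->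
  size t <= a.
Proof.
case: t => // h t srt ht.
have gt_h z : z \in t -> north_east h z.
  by move: srt; rewrite (sorted_pairwise north_east_trans) => /andP[/allP + _] => /[apply].
have [_ _ /orP[ha|jh]] := ht h (mem_head _ _).
  rewrite -[leqRHS]subn0; apply: chain_height srt _ => z zt.
  have [_ z0 _] := ht z zt; rewrite z0; move: zt.
  rewrite in_cons => /predU1P[->//|/gt_h].
  by rewrite /north_east; lia.
rewrite -[leqRHS](addKn j); apply: chain_width srt _ => z zt.
have [zi _ _] := ht z zt; rewrite zi andbT; move: zt.
rewrite in_cons => /predU1P[->//|/gt_h].
by rewrite /north_east; lia.
Qed.

Lemma hull_rectangle a b i j t :
  (forall z : box, z \in t -> rectangle a b i j z) ->
  (hull t `<=` rectangle a b i j)%classic.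
Proof.
move=> ht [x1 x2] [[[? ?] /ht + /= h1] [[? ?] /ht + /= h2]
  [[? ?] /ht + /= h3] [[? ?] /ht + /= h4]].
by rewrite /rectangle /mkset /=; lia.
Qed.

(** The boxes of the chain that lie below or to the left of the rectangle number
    at most b, those above or to the right at most a, and the others, which are
    in G, at most k. *)
Lemma chain_free_bound k (M G : {fset box}) a b i j t :
  (rectangle a b i j `<=` [set` M])%classic -> ne_chain_free k M G ->
  sorted north_east t ->
  (forall z : box, z \in t ->
    [/\ z \notin (M `\` G)%fset, 0 < z.1 <= i + b & 0 < z.2 <= j + a]) ->
  size t <= a + b + k.
Proof.
move=> RM free srt ht.
pose P (z : box) := (i < z.1) || (z.2 <= b).
pose Q (z : box) := (z.1 <= a) || (j < z.2).
pose R (z : box) := (a < z.1 <= i) && (b < z.2 <= j).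
have srtf p : sorted north_east (filter p t).
  exact: (sorted_filter north_east_trans p srt).
have leP : count P t <= b.
  rewrite -size_filter; apply: (@chain_start_bound _ b i) => // z.
  by rewrite mem_filter => /andP[Pz /ht[_ h1 h2]]; split=> //; lia.
have leQ : count Q t <= a.
  rewrite -size_filter; apply: (@chain_end_bound _ a j) => // z.
  by rewrite mem_filter => /andP[Qz /ht[_ h1 h2]]; split=> //; lia.
have leR : count R t <= k.
  rewrite -size_filter leqNgt; apply/negP => ltk; apply: free.
  have inR z : z \in take k.+1 (filter R t) -> z \in t /\ rectangle a b i j z.
    by move/mem_take; rewrite mem_filter => /andP[].
  have inM z : z \in take k.+1 (filter R t) -> z \in M.
    by case/inR=> _ /RM.
  exists (take k.+1 (filter R t)); split.
  - by rewrite size_takel.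
  - move=> z zt; have zM := inM z zt; have [/ht[+ _ _] _] := inR z zt.
    by rewrite in_fsetD zM andbT negbK.
  - split=> //; first exact: take_sorted.
    move=> x /(@hull_rectangle a b i j) h; apply: RM; apply: h => z.
    by case/inR.
have : size t <= count P t + count Q t + count R t.
  elim: (t) => //= z s IH; rewrite /P /Q /R in IH *; lia.
lia.
Qed.

(** * Maximal rectangles of a moon polyomino *)

Lemma rectangle_sub a b i j a' b' i' j' : a < i -> b < j ->
  (rectangle a b i j `<=` rectangle a' b' i' j')%classic ->
  [/\ a' <= a, b' <= b, i <= i' & j <= j'].
Proof.
move=> ai bj sub; have := sub (a.+1, b.+1); have := sub (i, j).
by rewrite /rectangle /mkset /= => h1 h2; split; lia.
Qed.

(** Enlarging a rectangle as long as possible stops, because M lies in the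
    staircase. *)
Lemma exists_maximal_rectangle n (M : {fset box}) a b i j :
  in_staircase n M -> a < i -> b < j ->
  (rectangle a b i j `<=` [set` M])%classic ->
  exists a' b' i' j', maximal_rectangle M a' b' i' j' /\
    (rectangle a b i j `<=` rectangle a' b' i' j')%classic.
Proof.
move=> stair; have [m] := ubnP (a + b + (n - i) + (n - j)).
elim: m a b i j => // m IH a b i j hm ai bj RM.
have [max|nmax] := classic (maximal_rectangle M a b i j).
  by exists a, b, i, j; split.
have [a' [b' [i' [j' [RM' sub ne]]]]] : exists a' b' i' j',
    [/\ (rectangle a' b' i' j' `<=` [set` M])%classic,
     (rectangle a b i j `<=` rectangle a' b' i' j')%classic &
     rectangle a' b' i' j' <> rectangle a b i j].
  apply: NNPP => none; apply: nmax; split=> // a' b' i' j' RM' sub.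
  by apply: NNPP => ne; apply: none; exists a', b', i', j'.
have [h1 h2 h3 h4] := rectangle_sub ai bj sub.
have : i' + j' <= n by apply: (stair (i', j')); apply: RM'; rewrite /rectangle /mkset /=; lia.
move=> hn.
have ne' : ~ [/\ a' = a, b' = b, i' = i & j' = j].
  by case=> e1 e2 e3 e4; apply: ne; rewrite e1 e2 e3 e4.
have [|||a2 [b2 [i2 [j2 [max2 sub2]]]]] := IH a' b' i' j' _ _ _ RM'; try lia.
  have : ~~ [&& a' == a, b' == b, i' == i & j' == j].
    by apply/negP => /and4P[/eqP ? /eqP ? /eqP ? /eqP ?]; apply: ne'.
  lia.
by exists a2, b2, i2, j2; split=> // x /sub /sub2.
Qed.

(** Let (r, c) be such a box in M.  If column c contains all the rows of the
    rectangle, convexity of the rows extends the rectangle to column c.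
    Otherwise column c is not larger than any column of the rectangle, hence is
    contained in each of them, and convexity of the columns extends the
    rectangle to row r. *)
Lemma outside_corner (M : {fset box}) a b i j r c :
  moon_polyomino M -> maximal_rectangle M a b i j -> a < i -> b < j ->
  ~~ (a < r <= i) -> ~~ (b < c <= j) -> (r, c) \notin M.
Proof.
move=> [pos [convr convc] free _] [RM max] ai bj rout cout.
apply/negP => rcM; have [r0 c0] := pos _ rcM; rewrite /= in r0 c0.
have inM x y : a < x <= i -> b < y <= j -> (x, y) \in M.
  by move=> hx hy; apply: RM; rewrite /rectangle /mkset /= hx.
have maxE a' b' i' j' : (rectangle a' b' i' j' `<=` [set` M])%classic ->
    a' <= a -> b' <= b -> i <= i' -> j <= j' ->
    [/\ a <= a', b <= b', i' <= i & j' <= j].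
  move=> RM' h1 h2 h3 h4; apply: rectangle_sub; try lia.
  rewrite (max a' b' i' j') // => x; rewrite /rectangle /mkset /=; lia.
have [full|nfull] := classic (forall x, a < x <= i -> (x, c) \in M).
  have [|||||? ? ? ?] := maxE a (minn b c.-1) i (maxn j c); try lia.
  case=> x y /andP[/= hx hy].
  have [yc|cy] := leqP y c.
    have [yj|jy] := leqP y j.
      have [b_y|yb] := ltnP b y; first by apply: inM; lia.
      by apply: (convr x c y j); rewrite ?full ?inM //; lia.
    by apply: (convr x j y c); rewrite ?full ?inM //; lia.
  have [b_y|yb] := ltnP b y; first by apply: inM; lia.
  by apply: (convr x c y j); rewrite ?full ?inM //; lia.
have [x [hx xcM]] : exists x, a < x <= i /\ (x, c) \notin M.
  apply: NNPP => none; apply: nfull => x hx; apply/negPn/negP => xc.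
  by apply: none; exists x.
have rM y : b < y <= j -> (r, y) \in M.
  move=> hy; case: (free c y) => [/(_ r rcM)//|/(_ x)].
  by move=> h; case/negP: xcM; apply: h; apply: inM.
have [|||||? ? ? ?] := maxE (minn a r.-1) b (maxn i r) j; try lia.
case=> x' y /andP[/= hx' hy].
have [xr|rx] := leqP x' r.
  have [xi|ix] := leqP x' i.
    have [a_x|xa] := ltnP a x'; first by apply: inM; lia.
    by apply: (convc r x' i y); rewrite ?rM ?inM //; lia.
  by apply: (convc i x' r y); rewrite ?rM ?inM //; lia.
have [a_x|xa] := ltnP a x'; first by apply: inM; lia.
by apply: (convc r x' i y); rewrite ?rM ?inM //; lia.
Qed.

(** * Complements of fillings *)

Lemma pairwise_map_iota (f : nat -> box) m :
  (forall u v, u < v < m -> north_east (f u) (f v)) ->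
  pairwise north_east (map f (iota 0 m)).
Proof.
move=> hf; rewrite pairwise_map.
apply: (@sub_in_pairwise _ (gtn m) ltn); last 2 first.
- by apply/allP => u; rewrite mem_iota.
- by rewrite -(sorted_pairwise ltn_trans) iota_ltn_sorted.
by move=> u v _ /= vm uv; apply: hf; rewrite uv.
Qed.

Lemma chain_in_rectangle (h : box) t z : 0 < (last h t).1 -> 0 < h.2 ->
  sorted north_east (h :: t) -> z \in h :: t ->
  rectangle (last h t).1.-1 h.2.-1 h.1 (last h t).2 z.
Proof.
move=> l0 h0; rewrite (sorted_pairwise north_east_trans) => srt zt.
have /predU1P hz : (z == h) || north_east h z.
  move: zt; rewrite in_cons; case: eqP => //= _.
  by case/andP: srt => /allP + _; apply.
have /predU1P lz : (z == last h t) || north_east z (last h t).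
  move: srt zt; rewrite lastI pairwise_rcons mem_rcons in_cons.
  by case: eqP => //= _ /andP[/allP + _]; apply.
move: (last h t) h0 l0 hz lz => [l1 l2] {srt zt}; case: h z => [h1 h2] [z1 z2].
rewrite /rectangle /mkset /north_east /= => h0 l0.
by case=> [[? ?]|?] [[? ?]|?]; lia.
Qed.

(** The boxes [low] and [high] lengthen a chain of length k+1 by a + b turns
    outside M, and the label a + b + k at (i+b, j+a) then contradicts
    [rank_perm_chain]. *)
Lemma complement_chain_free n k M (s : 'S_n) D : moon_polyomino M ->
  in_staircase n M -> is_sigma k M s -> reduced_pipe_dream s M D ->
  ne_chain_free k M (M `\` D)%fset.
Proof.
move=> moon stair sigma [_ permD _ subD] [t [szt tMD [tM srt hullM]]].
have [pos _ _ _] := moon.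
have [a [b [i [j [max [ai bj inR]]]]]] : exists a b i j,
    maximal_rectangle M a b i j /\ [/\ a < i, b < j &
      forall z : box, z \in t -> rectangle a b i j z].
  case: t szt tMD tM srt hullM => // h t _ _ tM srt hullM.
  have [l1 _] := pos _ (tM _ (mem_last h t)).
  have [_ h2] := pos _ (tM _ (mem_head h t)).
  have inR z := @chain_in_rectangle h t z l1 h2 srt.
  have [|||a [b [i [j [max sub]]]]] := @exists_maximal_rectangle n M
      (last h t).1.-1 h.2.-1 h.1 (last h t).2 stair.
  - by have /andP[/andP[]] := inR h (mem_head _ _).
  - by have /andP[_ /andP[+ _]] := inR _ (mem_last h t).
  - move=> [x1 x2] Rx; apply: hullM.
    have [r1 r2 r3 r4] : [/\ (last h t).1 <= x1, x1 <= h.1, h.2 <= x2 &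
                            x2 <= (last h t).2].
      move: Rx l1 h2; rewrite /rectangle /mkset /=.
      by case: (last h t) (h) => [? ?] [? ?] /=; split; lia.
    by split; [exists (last h t) | exists h | exists h | exists (last h t)];
       rewrite ?mem_head ?mem_last.
  exists a, b, i, j; split=> //.
  have inR' z : z \in h :: t -> rectangle a b i j z by move=> /inR/sub.
  by have := inR' h (mem_head _ _); rewrite {1}/rectangle /mkset; split=> //; lia.
have out r c : ~~ (a < r <= i) -> ~~ (b < c <= j) -> (r, c) \notin D.
  move=> h1 h2; apply: contra (outside_corner moon max ai bj h1 h2).
  exact: (fsubsetP subD).
have ka : k < i - a.
  by rewrite -szt; apply: chain_height => // z /inR; rewrite /rectangle /mkset; lia.
have kb : k < j - b.
  by rewrite -szt; apply: chain_width => // z /inR; rewrite /rectangle /mkset; lia.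
have ess : essential_set s ((i + b, j + a), a + b + k).
  by rewrite sigma; exists a, b, i, j.
case: ess => /diagram_lt[pn qn] _ _ eqr.
pose low := [seq (i + b - u, u.+1) | u <- iota 0 b].
pose high := [seq (a - u, j + u.+1) | u <- iota 0 a].
have lowP z : z \in low -> [/\ i < z.1 <= i + b, 0 < z.2 <= b & z \notin D].
  case/mapP=> u; rewrite mem_iota => /andP[_ ub] -> /=.
  by split; [lia | lia | apply: out; lia].
have highP z : z \in high -> [/\ 0 < z.1 <= a, j < z.2 <= j + a & z \notin D].
  case/mapP=> u; rewrite mem_iota => /andP[_ ub] -> /=.
  by split; [lia | lia | apply: out; lia].
have := @rank_perm_chain n D s (i + b) (j + a) (low ++ t ++ high) pn qn permD.
rewrite -eqr !size_cat szt !size_map !size_iota => bound.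
suff : b + (k.+1 + a) <= a + b + k by lia.
apply: bound.
  rewrite (sorted_pairwise north_east_trans) !pairwise_cat.
  rewrite -(sorted_pairwise north_east_trans t) srt /=.
  rewrite !pairwise_map_iota ?andbT /=.
  - apply/andP; split; apply/allrelP => y z.
      case: y z => [y1 y2] [z1 z2] /lowP[/= hy1 hy2 _].
      rewrite mem_cat => /orP[/inR|/highP[/= hz1 hz2 _]];
        rewrite /rectangle /mkset /north_east /=; lia.
    case: y z => [y1 y2] [z1 z2] /inR + /highP[/= hz1 hz2 _].
    by rewrite /rectangle /mkset /north_east /=; lia.
  - by move=> u v; rewrite /north_east /=; lia.
  - by move=> u v; rewrite /north_east /=; lia.
move=> [z1 z2]; rewrite !mem_cat => /or3P[/lowP|zt|/highP] /=.
- by case=> h1 h2 zD; split=> //; lia.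
- have := inR _ zt; rewrite /rectangle /mkset /= => h; have := tMD _ zt.
  by rewrite in_fsetD => /andP[zD _]; split=> //; lia.
- by case=> h1 h2 zD; split=> //; lia.
Qed.

Lemma filling_contains_reduced n k M (s : 'S_n) G : moon_polyomino M ->
  in_staircase n M -> is_sigma k M s -> ne_chain_free k M G ->
  exists D, reduced_pipe_dream s (M `\` G)%fset D.
Proof.
move=> [pos _ _ _] stair sigma free.
have sub x : x \in (M `\` G)%fset -> x \in M by rewrite in_fsetD => /andP[].
apply: contains_reduced.
- by move=> x /sub; apply: pos.
- by move=> x /sub; apply: stair.
move=> p q l t; rewrite sigma => -[a [b [i [j [[RM _] _ _ [-> -> ->]]]]]] srt.
exact: chain_free_bound RM free srt.
Qed.

Theorem theorem1p4 (n k : nat) (M : {fset box}) (s : 'S_n) :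
  moon_polyomino M -> 0 < k -> in_staircase n M -> is_sigma k M s ->
  set_bij [set F : {fset box} | ne_filling k M F]%classic
          [set D : {fset box} | reduced_pipe_dream s M D]%classic
          (fun F : {fset box} => (M `\` F)%fset).
Proof.
move=> moon _ stair sigma.
have [pos _ _ _] := moon.
have card_dream D : reduced_pipe_dream s M D ->
    #|` D|%fset = #|inversions n (extend (s^-1)%g)|.
  case=> stairD permD redD DM; apply: card_reduced => // x xD.
  by apply: pos; apply: (fsubsetP DM).
have dream_in G : ne_chain_free k M G -> exists2 D : {fset box},
    reduced_pipe_dream s M D & (D `<=` M `\` G)%fset.
  move=> free; have [D [h1 h2 h3 h4]] := filling_contains_reduced moon stair sigma free.
  by exists D => //; split=> //; apply: fsubset_trans h4 (fsubsetDl _ _).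
split.
- move=> F /= [FM free max]; have [D dreamD DMF] := dream_in F free.
  have DM : (D `<=` M)%fset by case: dreamD.
  suff -> : F = (M `\` D)%fset by rewrite fsetDK.
  apply/eqP; rewrite eqEfcard; apply/andP; split.
    by rewrite -(fsetDK FM) fsetDS.
  apply: max; first exact: fsubsetDl.
  exact: complement_chain_free dreamD.
- move=> F1 F2; rewrite !inE /= => -[F1M _ _] [F2M _ _] eqD.
  by rewrite -(fsetDK F1M) eqD fsetDK.
- move=> D /= dreamD; have DM : (D `<=` M)%fset by case: dreamD.
  exists (M `\` D)%fset; last by rewrite fsetDK.
  split; [exact: fsubsetDl | exact: complement_chain_free dreamD |].
  move=> G GM free; have [D' dreamD' D'MG] := dream_in G free.
  have := fsubset_leq_card D'MG; rewrite !cardfsDS // (card_dream D') //.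
  rewrite -(card_dream D) //; have := fsubset_leq_card DM.
  by have := fsubset_leq_card GM; lia.
Qed.
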